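(* For every König–Egerváry graph $G$, the inequality $$a(G)-\alpha(G)\le \mu(G)-2$$ represents the tight bound; that is, the inequality holds for every König–Egerváry graph $G$, and there exists a König–Egerváry graph for which equality $a(G)-\alpha(G)=\mu(G)-2$ holds.
   Context: All graphs are finite, undirected, without loops or multiple edges. For a graph $G$, $n(G)$ and $m(G)$ are its numbers of vertices and edges, $\alpha(G)$ is its independence number (maximum size of a set of pairwise non-adjacent vertices), and $\mu(G)$ is its matching number (maximum size of a set of edges no two of which share a vertex). $G$ is a König–Egerváry graph if $\alpha(G)+\mu(G)=n(G)$. If $d_1\le d_2\le\cdots\le d_n$ is the degree sequence of $G$, the annihilation number $a(G)$ is the largest integer $k$ such that $\sum_{i=1}^k d_i\le m(G)$.
   Formalization: The inequality is stated for König–Egerváry graphs with μ(G) ≥ 2; without this it fails (e.g. K_1, K_2, stars), and since a(G) ≥ α(G) always, it can hold only when μ(G) ≥ 2. *)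

(* Defs.v *)
From mathcomp Require Import all_boot all_order all_algebra.
Set Implicit Arguments. Unset Strict Implicit. Unset Printing Implicit Defensive.

Record sgraph := SGraph {
  vertex :> finType;
  adj : rel vertex;
  adj_sym : symmetric adj;
  adj_irrefl : irreflexive adj
}.

Section Invariants.
Variable G : sgraph.

Definition edges : {set {set G}} := [set [set p.1; p.2] | p : G * G & adj p.1 p.2].

Definition order_of : nat := #|G|.
Definition size_of : nat := #|edges|.

Definition independent (S : {set G}) : bool :=
  [forall x in S, forall y in S, ~~ adj x y].

Definition independence_number : nat := \max_(S : {set G} | independent S) #|S|.

Definition matching (M : {set {set G}}) : bool := (M \subset edges) && trivIset M.

Definition matching_number : nat := \max_(M : {set {set G}} | matching M) #|M|.

Definition degree (v : G) : nat := #|[set w | adj v w]|.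

Definition degree_sequence : seq nat := sort leq [seq degree v | v <- enum G].

Definition annihilation_number : nat :=
  \max_(k < order_of.+1 | sumn (take k degree_sequence) <= size_of) k.

Definition konig_egervary : Prop :=
  independence_number + matching_number = order_of.

End Invariants.

(* Main.v *)
(** The annihilation number never exceeds [n - 2] once there are two disjoint
    edges: the degree sum is at least [2m], and a vertex of maximum degree
    misses one of the two edges, so its degree is less than [m]; hence the
    [n - 1] smallest degrees already sum to more than [m].  For a
    König–Egerváry graph [n - 2 = alpha + mu - 2].  Equality holds for two
    disjoint copies of [K_2]. *)
Require Import Defs.
From mathcomp Require Import all_boot all_order all_algebra.
From mathcomp Require Import zify.
Import Order.TTheory GRing.Theory Num.Theory.
Local Open Scope ring_scope.

Section GraphBounds.
Local Open Scope nat_scope.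
Variable G : sgraph.

Lemma edgesP (e : {set G}) :
  reflect (exists x y : G, adj x y /\ e = [set x; y]) (e \in edges G).
Proof.
apply: (iffP imsetP) => [[[x y]]|[x [y [xy ->]]]].
  by rewrite inE => /= xy ->; exists x, y.
by exists (x, y); rewrite ?inE.
Qed.

Lemma adj_neq (x y : G) : adj x y -> x != y.
Proof. by move=> xy; apply/eqP => E; rewrite E adj_irrefl in xy. Qed.

Lemma matching_incident_unique (M : {set {set G}}) (e f : {set G}) (v : G) :
  matching M -> e \in M -> f \in M -> v \in e -> v \in f -> e = f.
Proof.
move=> /andP [_ /trivIsetP tM] eM fM ve vf.
by apply: contraTeq vf => ef; rewrite (disjointFr (tM _ _ eM fM ef) ve).
Qed.

(** The degree sum counts ordered adjacent pairs. Grouped by underlying edge, each class contains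
    both orientations, which differ because there are no loops. *)
Lemma double_size_leq_sum_degree : (size_of G).*2 <= \sum_(v : G) degree v.
Proof.
have -> : \sum_(v : G) degree v = \sum_(p : G * G | adj p.1 p.2) 1.
  rewrite (eq_bigr (fun v => \sum_(w | adj v w) 1)) ?pair_big_dep //.
  by move=> v _; rewrite sum1_card /degree cardsE.
rewrite (partition_big (fun p : G * G => [set p.1; p.2]) (mem (edges G))) /=;
  last by move=> [x y] /= xy; apply/edgesP; exists x, y.
rewrite -muln2 /size_of -sum_nat_const; apply: leq_sum => e /edgesP [x [y [xy ->]]].
rewrite sum1dep_card.
have <- : #|[set (x, y); (y, x)]| = 2.
  rewrite cards2; suff -> : (x, y) != (y, x) by [].
  by apply: contra (adj_neq _ _ xy) => /eqP [-> _].
apply/subset_leq_card/subsetP => p; rewrite !inE => /orP [] /eqP -> /=.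
  by rewrite xy eqxx.
by rewrite adj_sym xy setUC eqxx.
Qed.

(** The map [w |-> [set v; w]] injects the neighbours of [v] into the edges other than [e]. *)
Lemma degree_lt_size (v : G) (e : {set G}) :
  e \in edges G -> v \notin e -> degree v < size_of G.
Proof.
move=> eE ve; rewrite /size_of (cardsD1 e) eE ltnS /degree.
have inj : {in [set w | adj v w] &, injective (fun w => [set v; w])}.
  move=> a b; rewrite !inE => va vb E.
  have: a \in [set v; b] by rewrite -E set22.
  by rewrite !inE eq_sym (negbTE (adj_neq _ _ va)) => /eqP.
rewrite -(card_in_imset inj); apply/subset_leq_card/subsetP => f /imsetP [w].
rewrite !inE => vw ->; apply/andP; split.
  by apply: contraNneq ve => <-; rewrite set21.
by apply/edgesP; exists v, w.
Qed.

Lemma matching_number_witness : exists2 M : {set {set G}},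
  matching M & #|M| = matching_number G.
Proof.
have h : 0 < #|[pred M : {set {set G}} | matching M]|.
  apply/card_gt0P; exists set0; rewrite inE /matching sub0set.
  by apply/trivIsetP => A B; rewrite inE.
have [M mM E] := eq_bigmax_cond (fun M : {set {set G}} => #|M|) h.
by exists M.
Qed.

Lemma degree_lt_size_matching (v : G) :
  2 <= matching_number G -> degree v < size_of G.
Proof.
have [M mM <-] := matching_number_witness; move=> /card_gt1P [e [f [eM fM ef]]].
have sub : {subset M <= edges G} by apply/subsetP; case/andP: mM.
have [ve|] := boolP (v \in e); last exact/degree_lt_size/sub.
apply: (@degree_lt_size v f); first exact: sub.
by apply: contra ef => vf; apply/eqP/(matching_incident_unique _ _ _ v mM).
Qed.

Lemma size_degree_sequence : size (degree_sequence G) = order_of G.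
Proof. by rewrite size_sort size_map -cardE. Qed.

Lemma sumn_degree_sequence : sumn (degree_sequence G) = \sum_(v : G) degree v.
Proof.
rewrite (perm_sumn (permEl (perm_sort _ _))) sumnE big_map big_enum /=.
by apply: eq_bigl.
Qed.

Lemma leq_sumn_take (s : seq nat) (i j : nat) :
  i <= j -> sumn (take i s) <= sumn (take j s).
Proof.
by move=> ij; rewrite -(subnKC ij) takeD sumn_cat leq_addr.
Qed.

Lemma annihilation_number_le :
  2 <= matching_number G -> annihilation_number G + 2 <= order_of G.
Proof.
move=> mu2.
(* Ensures that the subtraction of 2 below is not truncated and that the index [(order_of G).-1]
   lies in the degree sequence. *)
have n2 : 2 <= order_of G.
  have [M mM EM] := matching_number_witness.
  move: mu2; rewrite -EM => /card_gt1P [e [_ [eM _ _]]].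
  have /edgesP [x [y [xy _]]] : e \in edges G.
    by apply: (subsetP _ _ eM); case/andP: mM.
  by apply/card_gt1P; exists x, y; rewrite adj_neq.
suff : annihilation_number G <= (order_of G) - 2 by lia.
apply/bigmax_leqP => k hk; rewrite leqNgt; apply/negP => kn.
(* A [k] above [n - 2] would make the sum of the [n - 1] smallest degrees at most [m]. *)
have {kn} := leq_sumn_take (degree_sequence G) (order_of G).-1 k ltac:(lia).
(* The remaining last entry is the degree of some vertex, hence less than [m], so the total would
   fall below [2m]. *)
have : sumn (degree_sequence G) = sumn (take (order_of G).-1 (degree_sequence G))
    + nth 0 (degree_sequence G) (order_of G).-1.
  rewrite -[LHS](congr1 sumn (cat_take_drop (order_of G).-1 _)) sumn_cat.
  rewrite (drop_nth 0) ?size_degree_sequence ?prednK ?drop_oversize /= ?addn0 //;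
    by rewrite ?size_degree_sequence; lia.
have /mapP [v _ ->] : nth 0 (degree_sequence G) (order_of G).-1
    \in [seq degree v | v <- enum G].
  by rewrite -(mem_sort leq) mem_nth // size_degree_sequence; lia.
have := degree_lt_size_matching v mu2; have := double_size_leq_sum_degree.
by rewrite sumn_degree_sequence; lia.
Qed.

(* Every edge of a matching has an end outside the independent set [S], and
   these ends are pairwise distinct. *)
Lemma independent_matching_card (S : {set G}) (M : {set {set G}}) :
  independent S -> matching M -> #|S| + #|M| <= order_of G.
Proof.
move=> iS mM; rewrite /order_of -(cardsC S) leq_add2l.
pose f (e : {set G}) := [pick x in e :\: S].
have fP e : e \in M -> exists2 x, f e = Some x & (x \in e) && (x \notin S).
  move=> eM; rewrite /f; case: pickP => [x|none].
    by rewrite inE andbC => xe; exists x.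
  have /edgesP [x [y [xy Ee]]] : e \in edges G.
    by apply: (subsetP _ _ eM); case/andP: mM.
  have inS z : z \in e -> z \in S.
    by move=> ze; move: (none z); rewrite inE ze andbT => /negbFE.
  have xS : x \in S by rewrite inS // Ee set21.
  have yS : y \in S by rewrite inS // Ee set22.
  by move/forall_inP/(_ x xS)/forall_inP/(_ y yS): iS; rewrite xy.
have inj : {in M &, injective f}.
  move=> e1 e2 e1M e2M; have [x -> /andP [x1 _]] := fP _ e1M.
  have [y -> /andP [y2 _]] := fP _ e2M => -[xy]; rewrite -xy in y2.
  exact: (matching_incident_unique _ _ _ x mM).
(* Since [f] takes values in [option G], the complement of [S] is embedded there by [Some] before
   comparing. *)
rewrite -(card_in_imset inj) -(card_imset _ (@Some_inj _ : injective (@Some G))).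
apply/subset_leq_card/subsetP => _ /imsetP [e eM ->].
have [x -> /andP [_ xS]] := fP _ eM.
by apply/imsetP; exists x; rewrite // inE.
Qed.

(** Weak duality: when the bound of [independent_matching_card] is attained, [S] and [M] certify
    each other as maximum. *)
Lemma independent_matching_witness (S : {set G}) (M : {set {set G}}) :
  independent S -> matching M -> #|S| + #|M| = order_of G ->
  independence_number G = #|S| /\ matching_number G = #|M|.
Proof.
move=> iS mM E.
have aS : #|S| <= independence_number G by apply: leq_bigmax_cond.
have aM : #|M| <= matching_number G by apply: leq_bigmax_cond.
split; apply/eqP; rewrite eqn_leq ?aS ?aM andbT; apply/bigmax_leqP.
  by move=> T iT; have := independent_matching_card _ _ iT mM; lia.
by move=> N mN; have := independent_matching_card _ _ iS mN; lia.
Qed.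

End GraphBounds.

(** The first coordinate names the copy of [K_2], the second the end within it. *)
Definition adj2K2 : rel (bool * bool) := fun x y => (x.1 == y.1) && (x.2 != y.2).

Lemma adj2K2_sym : symmetric adj2K2.
Proof. by move=> x y; rewrite /adj2K2 eq_sym [y.2 == _]eq_sym. Qed.

Lemma adj2K2_irrefl : irreflexive adj2K2.
Proof. by move=> x; rewrite /adj2K2 !eqxx. Qed.

Definition two_K2 : sgraph := SGraph adj2K2_sym adj2K2_irrefl.

Section TwoK2.
Local Open Scope nat_scope.

Definition edge2K2 (b : bool) : {set two_K2} := [set (b, false); (b, true)].

Lemma mem_edge2K2 (b : bool) (p : two_K2) : (p \in edge2K2 b) = (p.1 == b).
Proof. by case: p b => [[] []] []; rewrite !inE. Qed.

Lemma matching_two_K2 : matching (edge2K2 @: [set: bool]).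
Proof.
apply/andP; split.
  by apply/subsetP => _ /imsetP [b _ ->]; apply/edgesP;
    exists (b, false), (b, true); rewrite /= /adj2K2 eqxx.
apply/trivIsetP => _ _ /imsetP [b _ ->] /imsetP [c _ ->] bc.
rewrite disjoint_subset; apply/subsetP => p; rewrite mem_edge2K2 => /eqP pb.
by rewrite inE; apply: contra bc; rewrite mem_edge2K2 pb => /eqP ->.
Qed.

Lemma card_matching_two_K2 : #|edge2K2 @: [set: bool]| = 2.
Proof.
rewrite card_imset ?cardsT ?card_bool // => b c E.
have : (b, true) \in edge2K2 c by rewrite -E mem_edge2K2.
by rewrite mem_edge2K2 => /eqP.
Qed.

Lemma order_two_K2 : order_of two_K2 = 4.
Proof. by rewrite /order_of card_prod card_bool. Qed.

Lemma invariants_two_K2 :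
  independence_number two_K2 = 2 /\ matching_number two_K2 = 2.
Proof.
(* One end from each copy; with the two edges this attains 2 + 2 = 4, the order. *)
pose S : {set two_K2} := [set (false, true); (true, true)].
have cS : #|S| = 2 by rewrite cards2.
have iS : independent S.
  by apply/forall_inP => x; rewrite !inE => /orP [] /eqP ->;
     apply/forall_inP => y; rewrite !inE => /orP [] /eqP ->.
rewrite -{1}cS -card_matching_two_K2.
apply: independent_matching_witness iS matching_two_K2 _.
by rewrite cS card_matching_two_K2 order_two_K2.
Qed.

Lemma degree_two_K2 (v : two_K2) : degree v = 1.
Proof.
rewrite /degree -(cards1 ((v.1, ~~ v.2) : two_K2)); congr #|pred_of_set _|.
by apply/setP => w; rewrite !inE; case: v w => [[] []] [[] []].
Qed.

Lemma annihilation_two_K2 : annihilation_number two_K2 = 2.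
Proof.
apply/eqP; rewrite eqn_leq; apply/andP; split.
  (* The upper bound is the general one, 4 - 2. *)
  have [_ mu] := invariants_two_K2.
  by have := annihilation_number_le two_K2; rewrite mu order_two_K2; lia.
have lt2 : 2 < (order_of two_K2).+1 by rewrite order_two_K2.
apply: (@leq_bigmax_cond _ _ _ (Ordinal lt2)) => /=.
have -> : degree_sequence two_K2 = nseq (order_of two_K2) 1.
  rewrite -size_degree_sequence; apply/all_pred1P/allP => d.
  by rewrite mem_sort => /mapP [v _ ->]; rewrite /= degree_two_K2.
(* The two smallest degrees sum to 2, and the perfect matching already supplies 2 edges. *)
rewrite order_two_K2 -[sumn _]/2 -card_matching_two_K2.
by apply/subset_leq_card; case/andP: matching_two_K2.
Qed.

End TwoK2.

(* The differences are taken in int, not truncated in nat.  The hypothesis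
   2 <= matching_number G cannot be dropped: since a(G) >= alpha(G), the
   inequality fails whenever mu(G) <= 1 (edgeless graphs, K_2, stars). *)
Theorem theorem4p3 :
  (forall G : sgraph, konig_egervary G -> (2 <= matching_number G)%N ->
     (annihilation_number G)%:Z - (independence_number G)%:Z
       <= (matching_number G)%:Z - 2%:Z) /\
  (exists G : sgraph, konig_egervary G /\
     (annihilation_number G)%:Z - (independence_number G)%:Z
       = (matching_number G)%:Z - 2%:Z).
Proof.
split=> [G ke mu2|].
  by have := annihilation_number_le G mu2; rewrite -ke; lia.
have [al mu] := invariants_two_K2; exists two_K2.
by rewrite /konig_egervary al mu order_two_K2 annihilation_two_K2.
Qed.
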